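(* Let $X$ be a Calabi-Yau complete intersection in a toric variety $Y$ corresponding to a nef partition, and consider the Tyurin degeneration of $X$ given by a refinement $L_0=L_{0,1}\otimes L_{0,2}$ of the nef partition, with associated quasi-Fano varieties $X_1$ and $\tilde X_2$ and common smooth anticanonical divisor $X_0$, as set up in the context. Let $I^{X}(q)$, $I^{X_0}(q)$, $I^{X_1}(q,y)$, $I^{\tilde X_2}(q,y)$ be the functions defined in the context, which encode bases of solutions to the corresponding Picard-Fuchs equations. Then, upon setting $p_0=\rho_{0,2}$ in $I^{\tilde X_2}$, $$I^{X}(q)\star_q I^{X_0}(q)=\frac{1}{2\pi i}\oint I^{X_1}(q,y)\star_q I^{\tilde{X}_2}(q,y)\frac{dy}{y}.$$
   Context: **Geometry.** $Y$ is a smooth projective toric variety with toric divisor classes $D_1,\dots,D_m\in H^2(Y,\mathbb Z)$ and a nef integral basis $p_1,\dots,p_r$ of $H^2(Y,\mathbb Z)$; write $D_j=\sum_{i=1}^r m_{ij}p_i$. A nef partition is a partition of the set of toric divisors into $s+1$ groups, indexed by $l=0,\dots,s$, such that for each $l$ the sum $\rho_l$ of the classes $D_j$ in group $l$ is $c_1(L_l)$ for a nef line bundle $L_l$; thus $-K_Y=\sum_{l=0}^s\rho_l$. $X\subset Y$ is the Calabi-Yau complete intersection cut out by a generic section $(s_0,\dots,s_s)$ of $L_0\oplus\cdots\oplus L_s$. A refinement with respect to $L_0$ is a splitting of group $0$ into two groups, $\{D_{j_1},\dots,D_{j_a}\}$ and $\{D_{j_{a+1}},\dots,D_{j_{a+b}}\}$,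 with sums $\rho_{0,1}=c_1(L_{0,1})$ and $\rho_{0,2}=c_1(L_{0,2})$, where $L_{0,1},L_{0,2}$ are nef line bundles and $L_0=L_{0,1}\otimes L_{0,2}$ (so $\rho_0=\rho_{0,1}+\rho_{0,2}$). $X_1$ and $X_2$ are the quasi-Fano complete intersections defined by generic sections of $L_{0,1}\oplus L_1\oplus\cdots\oplus L_s$ and $L_{0,2}\oplus L_1\oplus\cdots\oplus L_s$, with $s_{0,1},s_{0,2}$ the corresponding sections of $L_{0,1},L_{0,2}$. $\tilde X_2$ is the blow-up of $X_2$ along $X_2\cap\{s_0=0\}\cap\{s_{0,1}=0\}$. $X_0=X_1\cap\tilde X_2$ is the Calabi-Yau complete intersection in $Y$ defined by a generic section of $L_{0,1}\oplus L_{0,2}\oplus L_1\oplus\cdots\oplus L_s$. $X$ degenerates to $X_1\cup_{X_0}\tilde X_2$ (Tyurin degeneration). **Functions.** Let $\mathrm{NE}(Y)\subset H_2(Y,\mathbb R)$ be the cone generated by effective curves and $\mathrm{NE}(Y)_{\mathbb Z}=\mathrm{NE}(Y)\cap(H_2(Y,\mathbb Z)/\mathrm{tors})$. Let $q=(q_1,\dots,q_r)$, $q^d=q_1^{\langle p_1,d\rangle}\cdots q_r^{\langle p_r,d\rangle}$, and for $d\in\mathrm{NE}(Y)_{\mathbb Z}$ put $$A_d=\prod_{j=1}^m\frac{\prod_{k=-\infty}^0(D_j+k)}{\prod_{k=-\infty}^{\langle D_j,d\rangle}(D_j+k)}$$ (each quotient being understood as the finite product left after cancelling common factors). The functions take values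 in $H^*(Y)$ (with $p_0$ a further degree-two class, later set equal to $\rho_{0,2}$): $$I^{X}(q)=e^{\sum_{i=1}^r p_i\log q_i}\sum_{d\in\mathrm{NE}(Y)_{\mathbb Z}}A_d\left(\prod_{l=0}^s\prod_{k=1}^{\langle\rho_l,d\rangle}(\rho_l+k)\right)q^d,$$ $$I^{X_0}(q)=e^{\sum_{i=1}^r p_i\log q_i}\sum_{d\in\mathrm{NE}(Y)_{\mathbb Z}}A_d\left(\prod_{l=1}^s\prod_{k=1}^{\langle\rho_l,d\rangle}(\rho_l+k)\right)\prod_{k=1}^{\langle\rho_{0,1},d\rangle}(\rho_{0,1}+k)\prod_{k=1}^{\langle\rho_{0,2},d\rangle}(\rho_{0,2}+k)\,q^d,$$ $$I^{X_1}(q,y)=e^{\sum_{i=1}^r p_i\log\lambda_{i,1}}\sum_{d\in\mathrm{NE}(Y)_{\mathbb Z}}A_d\left(\prod_{l=1}^s\prod_{k=1}^{\langle\rho_l,d\rangle}(\rho_l+k)\right)\prod_{k=1}^{\langle\rho_{0,1},d\rangle}(\rho_{0,1}+k)\prod_{k=1}^{\langle\rho_{0,2},d\rangle}(\rho_{0,2}+k)\,\frac{q^d}{y^{\langle\rho_{0,2},d\rangle}},$$ where $\lambda_{i,1}=q_i\big/\prod_{k=a+1}^{a+b}y^{m_{ij_k}}$, and $$I^{\tilde X_2}(q,y)=e^{\sum_{i=1}^r p_i\log q_i+p_0\log y}\sum_{d\in\mathrm{NE}(Y)_{\mathbb Z},\,d_0\ge0}A_d\left(\prod_{l=1}^s\prod_{k=1}^{\langle\rho_l,d\rangle}(\rho_l+k)\right)\frac{\prod_{k=1}^{\langle\rho_{0,1},d\rangle+d_0}(\rho_{0,1}+p_0+k)\prod_{k=1}^{\langle\rho_{0,2},d\rangle}(\rho_{0,2}+k)}{\prod_{k=1}^{d_0}(p_0+k)}\,y^{d_0}q^d.$$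 **Conventions.** The Hadamard product with respect to $q$ is $\left(\sum_da_dq^d\right)\star_q\left(\sum_db_dq^d\right)=\sum_da_db_dq^d$, where $a_d,b_d$ may depend on other variables and are multiplied in the cohomology ring. In $\star_q$, each $\log q_i$ is treated as a variable independent of $q_i$; thus the exponential prefactors are part of the coefficients and are simply multiplied together. The integral $\frac1{2\pi i}\oint(\cdot)\frac{dy}{y}$ is the residue integral over a loop around $y=0$, i.e. it extracts the coefficient of $y^0$. *)

(* Defs.v *)
From HB Require Import structures.
From mathcomp Require Import all_boot all_order all_algebra.
From mathcomp Require Import ring_quotient generic_quotient.
From mathcomp Require Import complex.
From mathcomp Require Import boolp classical_sets fsbigop reals.
From mathcomp Require Import mpoly.

Set Implicit Arguments.
Unset Strict Implicit.
Unset Printing Implicit Defensive.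

Import Order.TTheory GRing.Theory Num.Theory.
Local Open Scope classical_set_scope.
Local Open Scope ring_scope.
Local Open Scope quotient_scope.

(* A smooth projective toric variety of dimension n with m toric divisors is
   given by its fan in Z^n: row j of [rays] is the primitive generator v_j of
   the ray of the toric divisor D_j, and each cone is recorded by the set of
   indices of its rays. *)

Section Fan.
Variables (R : realType) (n m : nat) (V : 'M[int]_(m, n)).
Implicit Types (S : {set {set 'I_m}}) (sigma : {set 'I_m}).

Definition in_cone sigma (x : 'rV[R]_n) : Prop :=
  exists a : 'I_m -> R, (forall j, 0 <= a j) /\
    x = \sum_(j in sigma) a j *: row j (map_mx intr V).

Definition is_fan S : Prop :=
  [/\ finset.set0 \in S,
      forall j : 'I_m, [set j]%SET \in S,
      forall sigma tau : {set 'I_m}, sigma \in S -> tau \subset sigma -> tau \in S &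
      forall (sigma tau : {set 'I_m}) x, sigma \in S -> tau \in S ->
        in_cone sigma x -> in_cone tau x -> in_cone (sigma :&: tau) x].

(* The generators of each cone are part of a Z-basis of Z^n (the rows of B). *)
Definition fan_smooth S : Prop :=
  forall sigma, sigma \in S ->
    exists2 B : 'M[int]_n, B \in unitmx &
    exists2 f : 'I_m -> 'I_n, {in sigma &, injective f} &
      forall j, j \in sigma -> row j V = row (f j) B.

Definition fan_complete S : Prop :=
  forall x : 'rV[R]_n, exists2 sigma, sigma \in S & in_cone sigma x.

(* The divisor \sum_j a_j D_j is ample: its support function is strictly
   convex. *)
Definition ample_divisor S (a : 'rV[int]_m) : Prop :=
  forall sigma, sigma \in S -> #|sigma| = n ->
    exists u : 'cV[int]_n, forall j : 'I_m,
      if j \in sigma then (V *m u) j 0 = - a 0 j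
      else - a 0 j < (V *m u) j 0.

End Fan.

Record smoothProjectiveToric (R : realType) (n m : nat) := SmoothProjectiveToric {
  rays : 'M[int]_(m, n);
  cones : {set {set 'I_m}};
  toric_fan : is_fan R rays cones;
  toric_smooth : fan_smooth rays cones;
  toric_complete : fan_complete R rays cones;
  toric_projective : exists a, ample_divisor rays cones a
}.

(* H^*(Y, C), in its Jurkiewicz-Danilov presentation: the quotient of
   C[X_1, .., X_m] (X_j is the class D_j) by the linear relations
   \sum_j <e_i, v_j> X_j and the Stanley-Reisner monomials of the non-cones. *)

Section Cohomology.
Variables (R : realType) (n m : nat) (Y : smoothProjectiveToric R n m).

Definition linear_relation (i : 'I_n) : {mpoly R[i][m]} :=
  \sum_(j < m) 'X_j *~ rays Y j i.

Definition stanley_reisner (sigma : {set 'I_m}) : {mpoly R[i][m]} :=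
  \prod_(j in sigma) 'X_j.

Definition toric_ideal : {mpoly R[i][m]} -> bool := fun f =>
  `[< exists (a : 'I_n -> {mpoly R[i][m]}) (b : {set 'I_m} -> {mpoly R[i][m]}),
      f = \sum_i a i * linear_relation i +
          \sum_(sigma | sigma \notin cones Y) b sigma * stanley_reisner sigma >].

Lemma toric_ideal_closed : idealr_closed toric_ideal.
Proof.
split.
- apply/asboolP; exists (fun=> 0), (fun=> 0).
  by rewrite !big1 ?addr0 // => i _; rewrite mul0r.
- apply/negP => /asboolP [a [b /(congr1 (mmap idfun (fun=> 0)))]].
  rewrite rmorph1 rmorphD !rmorph_sum /= !big1 ?addr0.
  + by move/eqP; rewrite oner_eq0.
  + move=> sigma nS; rewrite rmorphM /= rmorph_prod /=.
    have [j js] : exists j, j \in sigma.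
      apply/finset.set0Pn; apply: contraNneq nS => ->.
      by case: (toric_fan Y).
    by rewrite (bigD1 j) //= mmapX mmap1U mul0r mulr0.
  + move=> i _; rewrite rmorphM /= rmorph_sum /= [X in _ * X]big1 ?mulr0 //.
    by move=> j _; rewrite rmorphMz /= mmapX mmap1U mul0rz.
- move=> c f g /asboolP [a [b ->]] /asboolP [a' [b' ->]].
  apply/asboolP.
  exists (fun i => c * a i + a' i), (fun s => c * b s + b' s).
  rewrite mulrDr !mulr_sumr addrACA -!big_split /=.
  by congr (_ + _); apply: eq_bigr => i _; rewrite mulrDl mulrA.
Qed.

HB.instance Definition _ :=
  isIdealr.Build {mpoly R[i][m]} toric_ideal toric_ideal_closed.

Definition cohomology : Type :=
  {ideal_quot (toric_ideal : idealr {mpoly R[i][m]})}.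
HB.instance Definition _ := GRing.ComNzRing.on cohomology.
HB.instance Definition _ := NzRingQuotient.on cohomology.

Definition coh_unit (x : cohomology) : bool := `[< exists y, y * x = 1 >].
Definition coh_inv (x : cohomology) : cohomology :=
  if pselect (exists y, y * x = 1) is left ex then projT1 (cid ex) else x.

Lemma coh_mulVr : {in coh_unit, left_inverse 1 coh_inv *%R}.
Proof.
move=> x /asboolP xu; rewrite /coh_inv.
by case: pselect => // ex; case: (cid ex).
Qed.

Lemma coh_unitPl (x y : cohomology) : y * x = 1 -> coh_unit x.
Proof. by move=> yx; apply/asboolP; exists y. Qed.

Lemma coh_invr_out : {in [predC coh_unit], coh_inv =1 id}.
Proof.
move=> x /negP xu; rewrite /coh_inv.
by case: pselect => // ex; case: xu; apply/asboolP.
Qed.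

HB.instance Definition _ := GRing.ComNzRing_hasMulInverse.Build cohomology
  coh_mulVr coh_unitPl coh_invr_out.

Definition coh_scalar (c : R[i]) : cohomology := \pi_cohomology (c%:MP).

(* The exponential of a degree-two class: H^k(Y) = 0 for k > 2n, so that the
   exponential series stops at its n-th power. *)
Definition coh_exp (x : cohomology) : cohomology :=
  \sum_(0 <= k < n.+1) coh_scalar (k`!%:R^-1) * x ^+ k.

(* Divisors and curve classes.
   A row vector x stands for the toric divisor \sum_j x_j D_j, and
   H^2(Y, Z) = Z^m / (linear equivalence).  A row vector d with d V = 0 stands
   for the class in H_2(Y) (modulo torsion) such that <D_j, d> = d_j. *)

Definition toric_divisor (j : 'I_m) : 'rV[int]_m := delta_mx 0 j.

Definition lin_equiv (x y : 'rV[int]_m) : Prop :=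
  exists u : 'cV[int]_n, x - y = (rays Y *m u)^T.

Definition divisor_class (x : 'rV[int]_m) : cohomology :=
  \sum_(j < m) \pi_cohomology 'X_j *~ x 0 j.

Definition pairing (K : nzRingType) (x : 'rV[int]_m) (d : 'rV[K]_m) : K :=
  \sum_(j < m) (x 0 j)%:~R * d 0 j.

Definition in_H2 (K : nzRingType) (d : 'rV[K]_m) : Prop :=
  d *m map_mx intr (rays Y) = 0.

(* The class of the torus-invariant curve of the wall sigma :&: sigma', read
   off from the wall relation v_j + v_j' + \sum_(i in sigma :&: sigma') c_i v_i
   = 0, where j, j' are the rays of sigma, sigma' outside the wall. *)
Definition wall_curve (c : 'rV[int]_m) : Prop :=
  exists sigma sigma' : {set 'I_m},
    [/\ sigma \in cones Y /\ sigma' \in cones Y,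
        #|sigma| = n /\ #|sigma'| = n,
        #|sigma :&: sigma'|.+1 = n,
        in_H2 c &
        forall j, (j \notin sigma :|: sigma' -> c 0 j = 0) /\
          (j \in sigma :|: sigma' -> j \notin sigma :&: sigma' -> c 0 j = 1)].

(* By the toric cone theorem, the cone of effective curves is generated by the
   torus-invariant curves. *)
Definition NE (d : 'rV[R]_m) : Prop :=
  exists (N : nat) (c : 'I_N -> 'rV[int]_m) (a : 'I_N -> R),
    [/\ forall i, wall_curve (c i), forall i, 0 <= a i &
        d = \sum_(i < N) a i *: map_mx intr (c i)].

Definition NE_Z : set 'rV[int]_m :=
  [set d | in_H2 d /\ NE (map_mx intr d)].

Definition nef (x : 'rV[int]_m) : Prop :=
  forall d : 'rV[R]_m, NE d -> 0 <= pairing x d.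

Definition nef_integral_basis r (p : 'I_r -> 'rV[int]_m) : Prop :=
  (forall i, nef (p i)) /\
  (forall x, exists! c : 'rV[int]_r, lin_equiv x (\sum_i c 0 i *: p i)).

Definition rho (G : {set 'I_m}) : 'rV[int]_m := \sum_(j in G) toric_divisor j.

(* g sends the toric divisor D_j to the index of its group. *)
Definition group s (g : 'I_m -> 'I_s.+1) (l : 'I_s.+1) : {set 'I_m} :=
  [set j | g j == l]%SET.

Definition nef_partition s (g : 'I_m -> 'I_s.+1) : Prop :=
  forall l, group g l != finset.set0 /\ nef (rho (group g l)).

Definition nef_refinement (G G1 G2 : {set 'I_m}) : Prop :=
  [/\ G1 :|: G2 = G, G1 :&: G2 = finset.set0,
      G1 != finset.set0, G2 != finset.set0 &
      nef (rho G1) /\ nef (rho G2)].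

(* \prod_(k = 1)^z (x + k); z is never negative below, by nefness. *)
Definition rising (x : cohomology) (z : int) : cohomology :=
  if z is Posz N then \prod_(1 <= k < N.+1) (x + k%:R) else 1.

(* \prod_(k <= 0) (x + k) / \prod_(k <= z) (x + k) after cancellation of the
   common factors; Negz N is - (N + 1), which leaves the k in [- N, 0]. *)
Definition A_factor (x : cohomology) (z : int) : cohomology :=
  match z with
  | Posz N => (\prod_(1 <= k < N.+1) (x + k%:R))^-1
  | Negz N => \prod_(0 <= k < N.+1) (x - k%:R)
  end.

Definition A_coef (d : 'rV[int]_m) : cohomology :=
  \prod_(j < m) A_factor (divisor_class (toric_divisor j))
                         (pairing (toric_divisor j) d).

(* Formal series are given by their families of coefficients: [series S deg a]
   is \sum_(i in S) a_i x^(deg i), and its coefficient at x^e is the sum of the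
   a_i with deg i = e.  Series in q are indexed by 'rV[int]_r, and series in q
   and y by 'rV[int]_r and int. *)
Definition series (I E : choiceType) (S : set I) (deg : I -> E)
    (a : I -> cohomology) (e : E) : cohomology :=
  \sum_(i \in S `&` [set i | deg i = e]) a i.

(* The sum is finite for Laurent series in y bounded below. *)
Definition laurent_mul (f g : int -> cohomology) (k : int) : cohomology :=
  \sum_(i \in [set: int]) f i * g (k - i).

(* mul is the product of the ring to which the coefficients of q^e belong. *)
Definition hadamard (r : nat) (T : Type) (mul : T -> T -> T)
  (f g : 'rV[int]_r -> T) : 'rV[int]_r -> T := fun e => mul (f e) (g e).

(* (2 pi i)^-1 \oint F dy / y, where F is a function of the independent
   variables log y (the first argument) and q, y (as a series).  The integral
   over a loop around y = 0 makes sense only for a single-valued F, i.e. if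
   log y does not occur in F; the value is 0 by convention otherwise. *)
Definition loop_integral (r : nat)
    (F : R[i] -> 'rV[int]_r -> int -> cohomology) : 'rV[int]_r -> cohomology :=
  fun e => if `[< forall u v, F u = F v >] then F 0 e 0 else 0.

Section IFunctions.
Variables (r : nat) (p : 'I_r -> 'rV[int]_m).

(* q^d = \prod_i q_i ^ <p_i, d> *)
Definition q_deg (d : 'rV[int]_m) : 'rV[int]_r := \row_i pairing (p i) d.

(* t_i stands for log q_i and u for log y. *)
Definition I_X s (g : 'I_m -> 'I_s.+1) (t : 'I_r -> R[i])
    : 'rV[int]_r -> cohomology := fun e =>
  coh_exp (\sum_i coh_scalar (t i) * divisor_class (p i)) *
  series NE_Z q_deg (fun d => A_coef d *
    \prod_(l < s.+1) rising (divisor_class (rho (group g l)))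
                            (pairing (rho (group g l)) d)) e.

Definition I_X0 s (g : 'I_m -> 'I_s.+1) (G1 G2 : {set 'I_m})
    (t : 'I_r -> R[i]) : 'rV[int]_r -> cohomology := fun e =>
  coh_exp (\sum_i coh_scalar (t i) * divisor_class (p i)) *
  series NE_Z q_deg (fun d => A_coef d *
    \prod_(l < s.+1 | l != ord0) rising (divisor_class (rho (group g l)))
                                        (pairing (rho (group g l)) d) *
    rising (divisor_class (rho G1)) (pairing (rho G1) d) *
    rising (divisor_class (rho G2)) (pairing (rho G2) d)) e.

(* mm i j is the integer m_ij with D_j = \sum_i m_ij p_i. *)
Definition I_X1 (mm : 'M[int]_(r, m)) s (g : 'I_m -> 'I_s.+1)
    (G1 G2 : {set 'I_m}) (t : 'I_r -> R[i]) (u : R[i])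
    : 'rV[int]_r -> int -> cohomology := fun e k =>
  let log_lambda i := t i - \sum_(j in G2) (mm i j)%:~R * u in
  coh_exp (\sum_i coh_scalar (log_lambda i) * divisor_class (p i)) *
  series NE_Z (fun d => (q_deg d, - pairing (rho G2) d)) (fun d => A_coef d *
    \prod_(l < s.+1 | l != ord0) rising (divisor_class (rho (group g l)))
                                        (pairing (rho (group g l)) d) *
    rising (divisor_class (rho G1)) (pairing (rho G1) d) *
    rising (divisor_class (rho G2)) (pairing (rho G2) d)) (e, k).

Definition I_X2 s (g : 'I_m -> 'I_s.+1) (G1 G2 : {set 'I_m})
    (p0 : cohomology) (t : 'I_r -> R[i]) (u : R[i])
    : 'rV[int]_r -> int -> cohomology := fun e k =>
  coh_exp (\sum_i coh_scalar (t i) * divisor_class (p i) + coh_scalar u * p0) *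
  series [set dd0 : 'rV[int]_m * int | NE_Z dd0.1 /\ 0 <= dd0.2]
    (fun dd0 => (q_deg dd0.1, dd0.2))
    (fun dd0 => let: (d, d0) := dd0 in A_coef d *
      \prod_(l < s.+1 | l != ord0) rising (divisor_class (rho (group g l)))
                                          (pairing (rho (group g l)) d) *
      (rising (divisor_class (rho G1) + p0) (pairing (rho G1) d + d0) *
       rising (divisor_class (rho G2)) (pairing (rho G2) d) / rising p0 d0))
    (e, k).

End IFunctions.
End Cohomology.

Arguments I_X {R n m} Y {r} p {s} g t _.
Arguments I_X0 {R n m} Y {r} p {s} g G1 G2 t _.
Arguments I_X1 {R n m} Y {r} p mm {s} g G1 G2 t u _ _.
Arguments I_X2 {R n m} Y {r} p {s} g G1 G2 p0 t u _ _.

(* Main.v *)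
Require Import Defs.
From HB Require Import structures.
From mathcomp Require Import all_boot all_order all_algebra.
From mathcomp Require Import ring_quotient generic_quotient.
From mathcomp Require Import complex.
From mathcomp Require Import boolp classical_sets fsbigop reals.
From mathcomp Require Import mpoly.

Set Implicit Arguments.
Unset Strict Implicit.
Unset Printing Implicit Defensive.

Import Order.TTheory GRing.Theory Num.Theory.
Local Open Scope ring_scope.

(** The identity holds term by term. A class in H_2(Y) is determined by its
    pairings with a basis of H^2(Y, Z), so each of the four series has at most
    one term of given degree in q, and the Hadamard product multiplies the terms
    of one and the same curve class d. In the term of d, I_X1 has the single
    power y^(- <rho_02, d>); to reach y^0 it must meet the term of I_X2 with
    d_0 = <rho_02, d>, which exists because rho_02 is nef. At p_0 = rho_02 and
    this d_0, the denominator of I_X2 cancels the factor of rho_02, and what is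
    left of the numerator is the factor of rho_01 + rho_02 = rho_0: I_X1
    contributes the coefficient of I_X0 and I_X2 that of I_X
    ([refined_rising]). The loop integral also requires that log y drops out of
    the prefactors: by D_j = \sum_i m_ij p_i, the substitution
    log lambda_i = log q_i - \sum_j m_ij log y multiplies the prefactor of I_X1
    by e^(- rho_02 log y) ([log_lambda_class]), while that of I_X2 contains
    e^(p_0 log y) ([exp_log_lambda]).

    Both cancellations rest on the vanishing of H^k(Y) for k > 2 dim Y
    ([irrelevant_prod0]): it makes rho_02 nilpotent, hence rho_02 + k invertible
    for k > 0 ([rising_unit]), and makes the truncated exponential additive
    ([coh_expD]). In the Jurkiewicz-Danilov presentation the vanishing is the
    algebraic moving lemma ([prod_toric0]): in a monomial of degree more than n
    supported on a cone some divisor is repeated, and one copy of it can be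
    moved off the cone by a linear relation, which enlarges the support. *)

(** * Sequences and sums *)

Lemma not_uniq_mem_rem (T : eqType) (w : seq T) :
  ~~ uniq w -> exists2 j, j \in w & j \in rem j w.
Proof.
elim: w => //= x w IHw; rewrite negb_and negbK => /orP[xw|/IHw [j jw jr]].
  by exists x; rewrite ?mem_head //= eqxx.
exists j; first by rewrite inE jw orbT.
by case: eqP => // _; rewrite inE jr orbT.
Qed.

(** For comparing a product of truncated exponential series with a sum of
    binomial expansions. *)
Lemma sum_triangle (V : nmodType) (N : nat) (F : nat -> nat -> V) :
  (forall a b, (N <= a + b)%N -> F a b = 0) ->
  \sum_(0 <= a < N) \sum_(0 <= b < N) F a b =
  \sum_(0 <= k < N) \sum_(0 <= i < k.+1) F (k - i)%N i.
Proof.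
move=> F0; rewrite exchange_big_nat /=.
have -> : \sum_(0 <= k < N) \sum_(0 <= i < k.+1) F (k - i)%N i =
    \sum_(0 <= k < N) \sum_(0 <= i < N | (i < k.+1)%N) F (k - i)%N i.
  by apply: eq_big_nat => k /andP[_ kN]; rewrite (big_nat_widen _ _ N).
rewrite [RHS](exchange_big_dep_nat xpredT) //=.
apply: eq_big_nat => i /andP[_ iN].
rewrite (big_cat_nat (leq0n (N - i)) (leq_subr i N)) /=.
rewrite [X in _ + X]big_nat [X in _ + X]big1 ?addr0; last first.
  by move=> a /andP[+ _]; rewrite leq_subLR addnC; apply: F0.
rewrite [RHS](big_cat_nat (leq0n i) (ltnW iN)) /=.
rewrite [X in _ = X + _]big_nat_cond [X in _ = X + _]big_pred0
    ?add0r; last first.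
  by move=> k; rewrite ltnS /= ; case: leqP => // _; rewrite andbF.
rewrite -{3}(add0n i) big_addn big_nat [RHS]big_nat_cond.
apply: eq_big => a; last by move=> _; rewrite addnK.
by rewrite ltnS leq_addl andbT.
Qed.

(** * The cohomology ring *)

Section Cohomology.
Variables (R : realType) (n m : nat) (Y : smoothProjectiveToric R n m).

Local Notation H := (cohomology Y).
Local Notation D j := (divisor_class Y (toric_divisor j)).

Lemma divisor_class_is_zmod_morphism : zmod_morphism (divisor_class Y).
Proof.
move=> x y; rewrite /divisor_class -sumrB; apply: eq_bigr => j _.
by rewrite !mxE mulrzBr.
Qed.

HB.instance Definition _ :=
  GRing.isZmodMorphism.Build 'rV[int]_m H (divisor_class Y)
    divisor_class_is_zmod_morphism.

Lemma divisor_class_toric j : D j = \pi_H%qT 'X_j.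
Proof.
rewrite /divisor_class (bigD1 j) //= big1 ?addr0 => [|i ij].
  by rewrite mxE !eqxx mulr1z.
by rewrite mxE (negPf ij) andbF mulr0z.
Qed.

Lemma divisor_classE x : divisor_class Y x = \sum_j D j *~ x 0 j.
Proof. by apply: eq_bigr => j _; rewrite divisor_class_toric. Qed.

Lemma toric_ideal_pi0 f : toric_ideal Y f -> \pi_H%qT f = 0.
Proof.
move=> fI; rewrite -[0](rmorph0 \pi_H%qT); apply/eqP.
by rewrite -Quotient.idealrBE subr0.
Qed.

Lemma linear_relation0 i : \sum_j D j *~ rays Y j i = 0.
Proof.
under eq_bigr do rewrite divisor_class_toric -rmorphMz.
rewrite -rmorph_sum; apply: toric_ideal_pi0; apply/asboolP.
exists (fun k => (k == i)%:R), (fun=> 0).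
rewrite [X in _ + X]big1 ?addr0 => [|s _]; last by rewrite mul0r.
rewrite (bigD1 i) //= eqxx mul1r [X in _ + X]big1 ?addr0 // => k /negPf ->.
by rewrite mul0r.
Qed.

Lemma stanley_reisner0 (sigma : {set 'I_m}) :
  sigma \notin cones Y -> \prod_(j in sigma) D j = 0.
Proof.
move=> sN; under eq_bigr do rewrite divisor_class_toric.
rewrite -rmorph_prod; apply: toric_ideal_pi0; apply/asboolP.
exists (fun=> 0), (fun tau => (tau == sigma)%:R).
rewrite [X in _ = X + _]big1 ?add0r => [|k _]; last by rewrite mul0r.
rewrite (bigD1 sigma) //= eqxx mul1r [X in _ + X]big1 ?addr0 // => k.
case/andP=> _ /negPf ->.
by rewrite mul0r.
Qed.

Lemma divisor_class_principal (u : 'cV[int]_n) :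
  divisor_class Y (rays Y *m u)^T = 0.
Proof.
rewrite divisor_classE.
under eq_bigr do rewrite !mxE mulrz_sumr.
rewrite exchange_big big1 // => i _.
under eq_bigr do rewrite mulrzA.
by rewrite -mulrz_suml linear_relation0 mul0rz.
Qed.

Lemma divisor_class_lin_equiv x y :
  lin_equiv Y x y -> divisor_class Y x = divisor_class Y y.
Proof.
case=> u xy; apply/eqP.
by rewrite -subr_eq0 -raddfB xy /= divisor_class_principal.
Qed.

(** The generators of a smooth cone extend to a basis of Z^n, so a linear form u
    can take the value 1 on v_j and 0 on the other generators; the relation of u
    then expresses D_j through divisors outside the cone. *)
Lemma cone_moving (sigma : {set 'I_m}) j :
  sigma \in cones Y -> j \in sigma ->
  exists c : 'I_m -> int, D j = \sum_(i | i \notin sigma) D i *~ c i.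
Proof.
move=> sS js; have [B Bu [f f_inj fB]] := toric_smooth sS.
pose u := col (f j) (invmx B).
have Vu i : i \in sigma -> (rays Y *m u) i 0 = (i == j)%:R.
  move=> si; transitivity ((row i (rays Y) *m u) 0 0).
    by rewrite -row_mul [RHS]mxE.
  transitivity ((B *m invmx B) (f i) (f j)).
    by rewrite fB // -row_mul !mxE; apply: eq_bigr => k _; rewrite mxE.
  by rewrite mulmxV // mxE (inj_in_eq f_inj).
exists (fun i => - (rays Y *m u) i 0).
have := divisor_class_principal u; rewrite divisor_classE.
under eq_bigr do rewrite mxE.
rewrite (bigID (mem sigma)) /= (bigD1 j) //= Vu // eqxx mulr1z.
rewrite [X in _ + X + _]big1 ?addr0 => [|i /andP[si /negPf ij]]; last first.
  by rewrite Vu // ij.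
move/eqP; rewrite addr_eq0 => /eqP ->; rewrite -sumrN.
by apply: eq_bigr => i _; rewrite mulrNz.
Qed.

Lemma card_cone (sigma : {set 'I_m}) : sigma \in cones Y -> (#|sigma| <= n)%N.
Proof.
move=> sS; have [B _ [f f_inj _]] := toric_smooth sS.
by rewrite -(card_in_imset f_inj) -[leqRHS]card_ord max_card.
Qed.

(** Induction on the number of divisors that do not occur in w. If those that
    do occur span no cone, a Stanley-Reisner relation applies. Otherwise there
    are at most n of them, so that some D_j is repeated in w; moving one copy of
    it off the cone turns the product into a combination of products of the same
    length with one more divisor. *)
Lemma prod_toric0 (w : seq 'I_m) : (n < size w)%N -> \prod_(j <- w) D j = 0.
Proof.
have [k] := ubnP (m - #|[set j in w]|); elim: k w => // k IHk w.
rewrite ltnS => wk nw.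
have [wS|wN] := boolP ([set j in w] \in cones Y); last first.
  (* One copy of each divisor of w gives the Stanley-Reisner monomial. *)
  have [w' ww'] := perm_to_subseq (undup_subseq w).
  rewrite (perm_big _ ww') big_cat /= [X in X * _]big_uniq ?undup_uniq //=.
  rewrite (eq_bigl (fun j => j \in [set j in w])).
    by rewrite stanley_reisner0 ?mul0r.
  by move=> j; rewrite inE mem_undup.
have wNu : ~~ uniq w.
  apply: contraL nw => /card_uniqP wn; rewrite -leqNgt -wn.
  by rewrite -cardsE card_cone.
have [j jw jr] := not_uniq_mem_rem wNu.
have [c ->] : exists c : 'I_m -> int,
    \prod_(i <- w) D i =
    \sum_(i | i \notin w) (\prod_(h <- i :: rem j w) D h) *~ c i.
  have [|c jc] := cone_moving wS (j := j); first by rewrite inE.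
  exists c; rewrite (perm_big _ (perm_to_rem jw)) big_cons jc /= mulr_suml.
  by apply: eq_big => i; [rewrite inE | rewrite big_cons mulrzAl].
rewrite big1 // => i iw; rewrite IHk ?mul0rz //=; last first.
  by rewrite size_rem // prednK // (leq_ltn_trans _ nw).
suff -> : [set h in i :: rem j w] = i |: [set h in w].
  have iw' : i \notin [set h in w] by rewrite inE.
  rewrite cardsU1 iw'; apply: leq_trans wk; rewrite add1n.
  apply: ltn_sub2l => //; rewrite -[ltnRHS]card_ord -cardsT proper_card //.
  by apply/properP; split; [exact: finset.subsetT | exists i].
apply/setP => h; rewrite !inE; case: (h =P i) => //= _.
have [->|hj] := eqVneq h j; first by rewrite jr jw.
by rewrite (perm_mem (perm_to_rem jw)) inE (negPf hj).
Qed.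

(** The coefficients c_j are arbitrary classes: this is the ideal of the classes
    of positive degree, which contains H^2(Y, C). *)
Definition irrelevant (x : H) : Prop := exists c, x = \sum_j c j * D j.

Lemma irrelevantD x y : irrelevant x -> irrelevant y -> irrelevant (x + y).
Proof.
move=> [c ->] [d ->]; exists (fun j => c j + d j).
by rewrite -big_split; apply: eq_bigr => j _; rewrite mulrDl.
Qed.

Lemma irrelevantMl a x : irrelevant x -> irrelevant (a * x).
Proof.
move=> [c ->]; exists (fun j => a * c j).
by rewrite mulr_sumr; apply: eq_bigr => j _; rewrite mulrA.
Qed.

Lemma irrelevant_sum I (r : seq I) (F : I -> H) :
  (forall i, irrelevant (F i)) -> irrelevant (\sum_(i <- r) F i).
Proof.
move=> FI; apply: big_ind => // [|x y]; last exact: irrelevantD.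
by exists (fun=> 0); rewrite big1 // => j _; rewrite mul0r.
Qed.

Lemma irrelevant_divisor_class x : irrelevant (divisor_class Y x).
Proof.
exists (fun j => (x 0 j)%:~R); rewrite divisor_classE.
by apply: eq_bigr => j _; rewrite mulrzl.
Qed.

(** The factors of xs are expanded one by one, each giving a divisor that joins
    w, until [prod_toric0] applies. *)
Lemma irrelevant_prod0 (xs : seq H) (w : seq 'I_m) :
  (forall x, x \in xs -> irrelevant x) -> (n < size xs + size w)%N ->
  \prod_(x <- xs) x * \prod_(j <- w) D j = 0.
Proof.
elim: xs w => [|x xs IHxs] w xsI nw; first by rewrite big_nil mul1r prod_toric0.
have [c xc] := xsI x (mem_head _ _).
rewrite big_cons {1}xc -mulrA mulr_suml big1 // => j _.
rewrite -mulrA [D j * _]mulrCA -(big_cons _ _ j w xpredT (fun j => D j)).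
rewrite IHxs ?mulr0 //= ?addnS //.
by move=> y yxs; apply: xsI; rewrite inE yxs orbT.
Qed.

Lemma irrelevant_expM0 x y a b : irrelevant x -> irrelevant y ->
  (n < a + b)%N -> x ^+ a * y ^+ b = 0.
Proof.
move=> xI yI nab.
have := @irrelevant_prod0 (nseq a x ++ nseq b y) [::].
rewrite big_nil mulr1 big_cat /= !big_nseq !iter_mulr_1 => -> //.
  by move=> z; rewrite mem_cat !mem_nseq => /orP[] /andP[_ /eqP ->].
by rewrite size_cat !size_nseq addn0.
Qed.

Lemma coh_scalar_is_zmod_morphism : zmod_morphism (coh_scalar Y).
Proof. by move=> c d; rewrite /coh_scalar mpolyCB rmorphB. Qed.

Lemma coh_scalar_is_monoid_morphism : monoid_morphism (coh_scalar Y).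
Proof.
by split=> [|c d]; rewrite /coh_scalar ?mpolyCM ?rmorphM // mpolyC1 rmorph1.
Qed.

HB.instance Definition _ :=
  GRing.isZmodMorphism.Build R[i] H (coh_scalar Y) coh_scalar_is_zmod_morphism.
HB.instance Definition _ :=
  GRing.isMonoidMorphism.Build R[i] H (coh_scalar Y)
    coh_scalar_is_monoid_morphism.

(** The terms of the product of the two truncated series that are missing in the
    truncated series of x + y have total degree more than n, and vanish. *)
Lemma coh_expD x y : irrelevant x -> irrelevant y ->
  coh_exp (x + y) = coh_exp x * coh_exp y.
Proof.
move=> xI yI; pose s k := coh_scalar Y (k`!%:R^-1).
transitivity (\sum_(0 <= a < n.+1) \sum_(0 <= b < n.+1)
    (s a * x ^+ a) * (s b * y ^+ b)); last first.
  by rewrite mulr_suml; apply: eq_bigr => a _; rewrite mulr_sumr.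
rewrite sum_triangle => [|a b nab]; last first.
  by rewrite mulrACA irrelevant_expM0 // mulr0.
rewrite /coh_exp !big_nat; apply: eq_bigr => k _.
rewrite exprDn mulr_sumr [RHS]big_mkord; apply: eq_bigr => i _.
rewrite -[_ *+ 'C(k, i)]mulr_natl -(rmorph_nat (coh_scalar Y)) [LHS]mulrA.
rewrite -rmorphM [RHS]mulrACA -rmorphM; congr (coh_scalar Y _ * _).
have ik : (i <= k)%N by rewrite -ltnS.
have f0 j : j`!%:R != 0 :> R[i] by rewrite pnatr_eq0 -lt0n fact_gt0.
apply: (mulfI (f0 k)); rewrite mulrA mulfV // mul1r -(bin_fact ik) !natrM.
by rewrite -invfM [i`!%:R * _]mulrC mulfK // mulf_neq0.
Qed.

Lemma nat_unit k : (k.+1)%:R \is a @GRing.unit H.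
Proof.
by rewrite -(rmorph_nat (coh_scalar Y)) rmorph_unit // unitfE pnatr_eq0.
Qed.

(** Write N for k + 1. The unit N^(n+1) equals N^(n+1) - (- x)^(n+1), which is a
    multiple of N + x. *)
Lemma irrelevant_add_unit x k : irrelevant x -> x + (k.+1)%:R \is a GRing.unit.
Proof.
move=> xI.
have := subrXX (k.+1)%:R (- x) n.+1.
rewrite exprNn -[x ^+ n.+1]mulr1 -(expr0 x) irrelevant_expM0 ?addn0 //.
rewrite mulr0 subr0 opprK addrC => /esym eq_unit.
by have := unitrX n.+1 (nat_unit k); rewrite -eq_unit unitrM addrC => /andP[].
Qed.

Lemma rising_unit x z : irrelevant x -> rising x z \is a GRing.unit.
Proof.
move=> xI; case: z => [N|N] /=; last exact: unitr1.
rewrite big_nat; elim/big_ind: _ => [|a b au bu|[|k] //]; rewrite ?unitr1 //.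
  by rewrite unitrM au.
by move=> _; apply: irrelevant_add_unit.
Qed.

(** * Pairings with curve classes *)

Lemma pairing_principal (u : 'cV[int]_n) (d : 'rV[int]_m) :
  in_H2 Y d -> pairing (rays Y *m u)^T d = 0.
Proof.
move=> dH; have -> : pairing (rays Y *m u)^T d = (d *m rays Y *m u) 0 0.
  rewrite -mulmxA [RHS]mxE; apply: eq_bigr => j _.
  by rewrite [_^T _ _]mxE intz mulrC.
suff -> : d *m rays Y = 0 by rewrite mul0mx mxE.
by rewrite -[RHS]dH; congr (_ *m _); apply/matrixP => i j; rewrite mxE intz.
Qed.

Lemma pairingD x y (d : 'rV[int]_m) :
  pairing (x + y) d = pairing x d + pairing y d.
Proof.
rewrite /pairing -big_split; apply: eq_bigr => j _.
by rewrite mxE rmorphD mulrDl.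
Qed.

Lemma pairing_comb r (c : 'I_r -> int) (p : 'I_r -> 'rV[int]_m) d :
  pairing (\sum_i c i *: p i) d = \sum_i c i * pairing (p i) d.
Proof.
rewrite /pairing.
under eq_bigr do rewrite summxE rmorph_sum mulr_suml.
rewrite exchange_big; apply: eq_bigr => i _; rewrite mulr_sumr.
by apply: eq_bigr => j _; rewrite /= mxE !intz mulrA.
Qed.

Lemma pairing_toric j (d : 'rV[int]_m) : pairing (toric_divisor j) d = d 0 j.
Proof.
rewrite /pairing (bigD1 j) //= big1 ?addr0 => [|i /negPf ij].
  by rewrite mxE !eqxx mul1r.
by rewrite mxE ij andbF mul0r.
Qed.

Lemma pairing_lin_equiv x y (d : 'rV[int]_m) :
  lin_equiv Y x y -> in_H2 Y d -> pairing x d = pairing y d.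
Proof.
case=> u xy dH; rewrite -[x](subrK y) pairingD xy.
by rewrite pairing_principal // add0r.
Qed.

Lemma nef_pairing_ge0 x d : nef Y x -> NE_Z Y d -> 0 <= pairing x d.
Proof.
move=> xnef [_ /xnef].
suff -> : pairing x (map_mx intr d) = (pairing x d)%:~R :> R.
  by rewrite ler0z.
rewrite /pairing rmorph_sum; apply: eq_bigr => j _.
by rewrite mxE rmorphM /= intz.
Qed.

(** * Coefficients of formal series *)

Lemma series_inj (I E : choiceType) (S : set I) (deg : I -> E) (a : I -> H) i :
  S i -> (forall j, S j -> deg j = deg i -> j = i) ->
  series S deg a (deg i) = a i.
Proof.
move=> Si deg_inj; transitivity (\sum_(j \in [set i]%classic) a j);
  last exact: fsbig_set1.
congr (\sum_(j \in _) _); apply/seteqP; split=> [j []|j -> //].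
by move=> Sj /(deg_inj j Sj).
Qed.

Lemma series_out (I E : choiceType) (S : set I) (deg : I -> E) (a : I -> H) e :
  (forall i, S i -> deg i <> e) -> series S deg a e = 0.
Proof. by move=> SNe; apply: fsbig1 => i [Si /(SNe i Si)]. Qed.

Lemma laurent_mul_monomial (f g : int -> H) k0 k :
  (forall i, i != k0 -> f i = 0) -> laurent_mul f g k = f k0 * g (k - k0).
Proof.
move=> f0; transitivity (\sum_(i \in [set k0]%classic) f i * g (k - i));
    last first.
  exact: fsbig_set1.
apply/esym/fsbig_widen => // i [_ /= /eqP ik0].
by rewrite f0 // mul0r.
Qed.

(** The classes x and y may be zero divisors: for general f and g, scaling could
    make the support of the sum finite, where the unscaled sum is 0 by the
    convention for infinite supports. *)
Lemma laurent_mul_scale (x y : H) (f g : int -> H) k0 k :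
  (forall i, i != k0 -> f i = 0) ->
  laurent_mul (fun i => x * f i) (fun i => y * g i) k =
  x * y * laurent_mul f g k.
Proof.
move=> f0; rewrite !(laurent_mul_monomial _ (k0 := k0)) // 1?mulrACA // => i ik.
by rewrite f0 // mulr0.
Qed.

(** * Degrees in q, refinements and logarithms *)

Lemma divisor_class_rho (G : {set 'I_m}) :
  divisor_class Y (rho G) = \sum_(j in G) D j.
Proof. by rewrite raddf_sum. Qed.

Lemma rhoU (G G1 G2 : {set 'I_m}) :
  G1 :|: G2 = G -> G1 :&: G2 = finset.set0 -> rho G = rho G1 + rho G2.
Proof.
move=> <- G0; rewrite /rho -bigU /=; last by rewrite -finset.setI_eq0 G0.
by apply: eq_bigl => j; rewrite !inE.
Qed.

Section Basis.
Variables (r : nat) (p : 'I_r -> 'rV[int]_m) (mm : 'M[int]_(r, m)).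
Variable mmP : forall j, lin_equiv Y (toric_divisor j) (\sum_i mm i j *: p i).

(** The degree in q records the pairings with the p_i; the D_j are combinations
    of the p_i, and the entries of d are its pairings with the D_j. *)
Lemma q_deg_inj d d' :
  in_H2 Y d -> in_H2 Y d' -> q_deg p d = q_deg p d' -> d = d'.
Proof.
move=> dH d'H qdd'; apply/rowP => j.
rewrite -!pairing_toric !(pairing_lin_equiv (mmP j)) // !pairing_comb.
by apply: eq_bigr => i _; have /rowP/(_ i) := qdd'; rewrite !mxE => ->.
Qed.

Lemma log_lambda_class (G : {set 'I_m}) (t : 'I_r -> R[i]) (u : R[i]) :
  \sum_i coh_scalar Y (t i - \sum_(j in G) (mm i j)%:~R * u) *
    divisor_class Y (p i) =
  \sum_i coh_scalar Y (t i) * divisor_class Y (p i) -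
    coh_scalar Y u * divisor_class Y (rho G).
Proof.
under eq_bigr do rewrite rmorphB mulrBl.
rewrite sumrB; congr (_ - _).
under eq_bigr do rewrite rmorph_sum mulr_suml.
rewrite exchange_big divisor_class_rho mulr_sumr; apply: eq_bigr => j _.
rewrite (divisor_class_lin_equiv (mmP j)) raddf_sum mulr_sumr.
apply: eq_bigr => i _.
rewrite rmorphM rmorph_int /= -[X in X *: _]intz scaler_int raddfMz /=.
by rewrite mulrzAr -[RHS]mulrzl mulrA.
Qed.

End Basis.

(** The coefficient of I_X2 at d_0 = <rho_02, d> and p_0 = rho_02, up to A_d,
    becomes that of I_X: the factors of rho_02 cancel and those of
    rho_01 + rho_02 make up the factor of group 0. *)
Lemma refined_rising (s : nat) (g : 'I_m -> 'I_s.+1) (G1 G2 : {set 'I_m}) d :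
  nef_refinement Y (group g ord0) G1 G2 ->
  \prod_(l < s.+1 | l != ord0) rising (divisor_class Y (rho (group g l)))
                                      (pairing (rho (group g l)) d) *
    (rising (divisor_class Y (rho G1) + divisor_class Y (rho G2))
            (pairing (rho G1) d + pairing (rho G2) d) *
     rising (divisor_class Y (rho G2)) (pairing (rho G2) d) /
     rising (divisor_class Y (rho G2)) (pairing (rho G2) d)) =
  \prod_(l < s.+1) rising (divisor_class Y (rho (group g l)))
                          (pairing (rho (group g l)) d).
Proof.
move=> [G12 G0 _ _ _]; rewrite mulrK; last first.
  exact/rising_unit/irrelevant_divisor_class.
rewrite [RHS](bigD1 ord0) //= mulrC; congr (rising _ _ * _).
  by rewrite (rhoU G12 G0) raddfD.
by rewrite (rhoU G12 G0) pairingD.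
Qed.

Lemma exp_log_lambda (p0 x : H) (u : R[i]) : irrelevant x -> irrelevant p0 ->
  coh_exp (x - coh_scalar Y u * p0) * coh_exp (x + coh_scalar Y u * p0) =
  coh_exp x * coh_exp x.
Proof.
move=> xI p0I; have upI c : irrelevant (c * p0) by apply: irrelevantMl.
rewrite -mulNr -!coh_expD //; try exact: irrelevantD.
by rewrite addrACA mulNr addNr addr0.
Qed.

End Cohomology.

(** * The Hadamard product identity *)

Theorem theorem1p2 (R : realType) (n m r s : nat)
    (Y : smoothProjectiveToric R n m)
    (p : 'I_r -> 'rV[int]_m) (hp : nef_integral_basis Y p)
    (mm : 'M[int]_(r, m))
    (hmm : forall j, lin_equiv Y (toric_divisor j) (\sum_i mm i j *: p i))
    (g : 'I_m -> 'I_s.+1) (hg : nef_partition Y g)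
    (G1 G2 : {set 'I_m}) (hG : nef_refinement Y (group g ord0) G1 G2)
    (t : 'I_r -> R[i]) :
  hadamard *%R (I_X Y p g t) (I_X0 Y p g G1 G2 t) =
  loop_integral (fun u =>
    hadamard (@laurent_mul R n m Y)
      (I_X1 Y p mm g G1 G2 t u)
      (I_X2 Y p g G1 G2 (divisor_class Y (rho G2)) t u)).
Proof.
set P := \sum_i coh_scalar Y (t i) * divisor_class Y (p i).
have PI : irrelevant P.
  by apply: irrelevant_sum => i; apply/irrelevantMl/irrelevant_divisor_class.
pose rho2 := divisor_class Y (rho G2).
pose c0 d := A_coef Y d *
    \prod_(l < s.+1 | l != ord0) rising (divisor_class Y (rho (group g l)))
                                        (pairing (rho (group g l)) d) *
    rising (divisor_class Y (rho G1)) (pairing (rho G1) d) *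
    rising rho2 (pairing (rho G2) d).
pose c2 (dd0 : 'rV[int]_m * int) := let: (d, d0) := dd0 in A_coef Y d *
    \prod_(l < s.+1 | l != ord0) rising (divisor_class Y (rho (group g l)))
                                        (pairing (rho (group g l)) d) *
    (rising (divisor_class Y (rho G1) + rho2) (pairing (rho G1) d + d0) *
     rising rho2 (pairing (rho G2) d) / rising rho2 d0).
pose a e k := series (NE_Z Y)
  (fun d => (q_deg p d, - pairing (rho G2) d)) c0 (e, k).
pose b e k := series
  [set dd0 : 'rV[int]_m * int | NE_Z Y dd0.1 /\ 0 <= dd0.2]%classic
  (fun dd0 => (q_deg p dd0.1, dd0.2)) c2 (e, k).
have NEinj d d' : NE_Z Y d -> NE_Z Y d' -> q_deg p d = q_deg p d' -> d = d'.
  by move=> [dH _] [d'H _]; apply: (q_deg_inj hmm).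
have a_single d : NE_Z Y d ->
    forall k, k != - pairing (rho G2) d -> a (q_deg p d) k = 0.
  move=> dNE k /eqP kd; apply: series_out => d' d'NE.
  by case=> /(NEinj _ _ d'NE dNE) -> dk; apply: kd.
have a0 e : exists k0, forall k, k != k0 -> a e k = 0.
  have [[d [dNE <-]]|Ne] := pselect (exists d, NE_Z Y d /\ q_deg p d = e).
    by exists (- pairing (rho G2) d); apply: a_single.
  exists 0 => k _; apply: series_out => d dNE [de _].
  by apply: Ne; exists d.
(* Stated for all powers of y, since the integrand must be shown to be free of
   log y as a whole. *)
have F_E u : hadamard (@laurent_mul R n m Y) (I_X1 Y p mm g G1 G2 t u)
    (I_X2 Y p g G1 G2 rho2 t u) =
    fun e k => coh_exp P * coh_exp P * laurent_mul (a e) (b e) k.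
  apply/funext => e; apply/funext => k; have [k0 ak0] := a0 e.
  rewrite -(exp_log_lambda u PI (irrelevant_divisor_class Y (rho G2))).
  rewrite -(log_lambda_class hmm).
  exact: (laurent_mul_scale _ _ _ _ ak0).
rewrite /loop_integral; case: asboolP => [_|[]]; last first.
  by move=> u v; rewrite !F_E.
rewrite F_E; apply/funext => e.
rewrite /hadamard /I_X /I_X0 -/P mulrACA; congr (_ * _).
have [[d [dNE <-]]|Ne] := pselect (exists d, NE_Z Y d /\ q_deg p d = e);
    last first.
  have {}Ne d : NE_Z Y d -> q_deg p d <> e.
    by move=> dNE de; apply: Ne; exists d.
  have [k0 /laurent_mul_monomial ->] := a0 e.
  by rewrite /a !series_out ?mul0r // => d /Ne de [/de].
(* Without this, the exponent d_0 = <rho_02, d> would not occur in I_X2. *)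
have d2 : 0 <= pairing (rho G2) d.
  by case: hG => _ _ _ _ [_ /nef_pairing_ge0]; apply.
rewrite (laurent_mul_monomial _ _ (a_single d dNE)) add0r opprK.
have -> : a (q_deg p d) (- pairing (rho G2) d) = c0 d.
  by apply: (series_inj _ (i := d)) => // d' d'NE [/(NEinj _ _ d'NE dNE)].
have -> : b (q_deg p d) (pairing (rho G2) d) = c2 (d, pairing (rho G2) d).
  apply: (series_inj _ (i := (d, pairing (rho G2) d))) => //.
  by move=> [d' k'] [/= d'NE _] [/(NEinj _ _ d'NE dNE) -> ->].
have q_deg1 d' : NE_Z Y d' -> q_deg p d' = q_deg p d -> d' = d.
  by move=> d'NE; apply: NEinj.
rewrite !(series_inj _ dNE q_deg1) mulrC; congr (_ * _).
by rewrite /c2 -mulrA (refined_rising d hG).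
Qed.
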